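(* Let $X$ be a compact metric space and let $f: X\to X$ be a homeomorphism. Then $f$ has an expansive measure (i.e. $\mathcal{M}_{ex}(X,f)\neq\emptyset$) if and only if $f$ has a dense set of expansive measures with invariant support, i.e. there is a nonempty subset $\mathcal{R}\subset \mathcal{M}_{ex}(X,f)$, dense in $\mathcal{M}_{ex}(X,f)$ for the weak* topology, such that $f(\operatorname{Supp}(\mu))=\operatorname{Supp}(\mu)$ for every $\mu\in\mathcal{R}$.
   Context: Let $(X,d)$ be a compact metric space and $f:X\to X$ a homeomorphism. $\mathcal{M}(X)$ denotes the set of all Borel probability measures of $X$, with the weak* topology: $\mu_n\to\mu$ if and only if $\int\phi\, d\mu_n\to\int\phi\, d\mu$ for every continuous $\phi:X\to\mathbb{R}$. The support $\operatorname{Supp}(\mu)$ of $\mu\in\mathcal{M}(X)$ is the set of points $x\in X$ such that $\mu(U)>0$ for every neighborhood $U$ of $x$. A set $\Lambda\subset X$ is invariant if $f(\Lambda)=\Lambda$. For $x\in X$ and $\delta\ge 0$ put $\Gamma_\delta(x)=\{y\in X: d(f^i(x),f^i(y))\leq\delta \text{ for every } i\in\mathbb{Z}\}$. A measure $\mu\in\mathcal{M}(X)$ is expansive (for $f$) if there is $\delta>0$ such that $\mu(\Gamma_\delta(x))=0$ for every $x\in X$. $\mathcal{M}_{ex}(X,f)\subset\mathcal{M}(X)$ denotes the set of expansive measures of $f$, with the induced weak* topology. *)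

(* Defs.v *)
From HB Require Import structures.
From mathcomp Require Import all_boot all_order all_algebra.
From mathcomp Require Import all_classical all_reals all_analysis.

Set Implicit Arguments.
Unset Strict Implicit.
Unset Printing Implicit Defensive.

Import Order.TTheory GRing.Theory Num.Theory.
Import numFieldTopology.Exports numFieldNormedType.Exports.

Local Open Scope classical_set_scope.
Local Open Scope ring_scope.

(* The library only provides measurable types with a distinguished point; the
   point plays no role beyond making the space nonempty. *)
#[short(type="pmetricType")]
HB.structure Definition PointedMetric (K : numDomainType) :=
  { M of Metric K M & isPointed M }.

Notation borel X := (g_sigma_algebraType (@open X)).

Record homeomorphism (X : topologicalType) := Homeomorphism {
  homeo_fun :> X -> X ;
  homeo_inv : X -> X ;
  homeo_funK : cancel homeo_fun homeo_inv ;
  homeo_invK : cancel homeo_inv homeo_fun ;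
  homeo_fun_continuous : continuous homeo_fun ;
  homeo_inv_continuous : continuous homeo_inv }.

(* Recall that [Negz n] is the integer - (n + 1). *)
Definition iterz (X : topologicalType) (f : homeomorphism X) (i : int) : X -> X :=
  match i with
  | Posz n => iter n f
  | Negz n => iter n.+1 (homeo_inv f)
  end.

Section expansive_measures.
Context {R : realType} {X : pmetricType R}.

(* The initial topology for the maps [mu |-> \int phi dmu], where [phi] ranges
   over the continuous real-valued functions on [X]. *)
Definition weak_star : Type :=
  initial_topology (fun mu : probability (borel X) R =>
    (fun phi : continuousType X R => \int[mu]_x phi x)
      : {ptws continuousType X R -> R}).

HB.instance Definition _ := Topological.on weak_star.

Lemma weak_star_cvgP (F : set_system weak_star) (mu : weak_star) : Filter F ->
  F --> mu <->
  forall phi : X -> R, continuous phi ->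
    (fun nu : probability (borel X) R => \int[nu]_x phi x) @ F
      --> \int[mu : probability (borel X) R]_x phi x.
Proof.
move=> FF.
pose I (nu : probability (borel X) R) : {ptws continuousType X R -> R} :=
  fun phi => \int[nu]_x phi x.
have IP : I @ F --> I mu <-> forall phi : continuousType X R,
    (fun nu => I nu phi) @ F --> I mu phi.
  have sup := cvg_sup (fun phi : continuousType X R => Topological.class
    (initial_topology (fun g : continuousType X R -> R => g phi)))
    (I mu) (fmap_filter I FF).
  split=> [/sup.1 cI phi A nA|cI].
    apply: (cI phi (fun g => A (g phi))).
    exact: (@initial_continuous _ R
      (fun g : continuousType X R -> R => g phi) (I mu) A nA).
  apply/sup => phi A.
  rewrite (@nbhsE (initial_topology
    (fun g : continuousType X R -> R => g phi))) => -[_ [[B oB <-] Bmu] BA].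
  suff FB : F (fun nu => B (I nu phi)) by apply: filterS FB => nu; exact: BA.
  by apply: (cI phi); apply: open_nbhs_nbhs.
have FI : F --> mu <-> I @ F --> I mu.
  split=> [cF|cI A].
    exact: cvg_trans (cvg_app I cF)
      (@initial_continuous (probability (borel X) R) _ I mu).
  rewrite (@nbhsE (initial_topology I)) => -[_ [[B oB <-] Bmu] BA].
  suff FB : F (I @^-1` B) by apply: filterS FB => nu; exact: BA.
  by apply: cI; apply: open_nbhs_nbhs.
apply: iff_trans FI _; apply: iff_trans IP _.
by split=> [cI phi cphi|cI phi]; [exact: (cI (mkcts cphi))|
  exact: cI (@cts_fun _ _ phi)].
Qed.

(* A neighborhood need not be a Borel set, and [mu] is only meaningful on Borel
   sets. *)
Definition supp (mu : probability (borel X) R) : set X :=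
  [set x | forall U : set (borel X),
     nbhs (x : X) U -> measurable U -> (0 < mu U)%E].

Definition dynamical_ball (f : homeomorphism X) (delta : R) (x : X) : set X :=
  [set y | forall i : int, mdist (iterz f i x) (iterz f i y) <= delta].

Definition expansive (f : homeomorphism X) (mu : probability (borel X) R) :=
  exists2 delta : R, 0 < delta & forall x, mu (dynamical_ball f delta x) = 0%E.

Definition expansive_measures (f : homeomorphism X) : set weak_star :=
  [set mu | expansive f mu].

End expansive_measures.

Arguments weak_star {R} X.

(* [S] is dense in [A] for the topology induced on [A]. *)
Definition dense_in (T : topologicalType) (A S : set T) : Prop :=
  S `<=` A /\ dense (set_val @^-1` S : set (set_type A)).

(* Main.v *)
(* Every iterate of an expansive measure [mu] under [f] is expansive with the
   same constant, because [f] permutes the dynamical balls. Hence a mean [nu]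
   of all the images of [mu] under the iterates [f^i], i in Z, with positive
   weights, is expansive, and so is (1 - t) mu + t nu for 0 < t <= 1. A set is
   null for this measure if and only if it is null for all the images of [mu];
   the null sets are thus invariant under [f], and so is the support. Letting
   t tend to 0 gives the density. *)
Require Import Defs.
From HB Require Import structures.
From mathcomp Require Import all_boot all_order all_algebra.
From mathcomp Require Import all_classical all_reals all_analysis.
From mathcomp Require Import measurable_realfun.

Local Open Scope classical_set_scope.
Local Open Scope ring_scope.

Import Order.TTheory GRing.Theory Num.Theory.
Import numFieldTopology.Exports numFieldNormedType.Exports.

Set Implicit Arguments.
Unset Strict Implicit.
Unset Printing Implicit Defensive.

(** * Integer iterates of a homeomorphism and their action on dynamical balls *)

Section iterz_theory.
Context {X : topologicalType} (f : homeomorphism X).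

Lemma iterz_homeo (i : int) (x : X) : iterz f i (f x) = iterz f (i + 1) x.
Proof.
(* The cases are [i >= 0], [i = -1] and [i <= -2]; in the last two, [f x] is cancelled by the
   innermost [homeo_inv f]. *)
case: i => [n|[|n]]; first by rewrite addrC -intS /= -iterSr.
  by rewrite /= homeo_funK.
have -> : Negz n.+1 + 1 = Negz n
  by rewrite !NegzE [in LHS]intS opprD addrAC addNr add0r.
by rewrite /iterz iterSr homeo_funK.
Qed.

Lemma iterz_homeo_inv (i : int) (x : X) :
  iterz f i (homeo_inv f x) = iterz f (i - 1) x.
Proof. by rewrite -{2}[x](homeo_invK f) iterz_homeo subrK. Qed.

(** The steps of [j] are absorbed one at a time into the outer exponent, which therefore varies in
    both inductions. *)
Lemma iterzD (i j : int) (x : X) : iterz f i (iterz f j x) = iterz f (i + j) x.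
Proof.
have pos (n : nat) k y : iterz f k (iter n f y) = iterz f (k + n%:Z) y.
  elim: n k => [|n IH] k; first by rewrite addr0.
  by rewrite iterS iterz_homeo IH -addrA -intS.
have neg (n : nat) k y : iterz f k (iter n (homeo_inv f) y) =
    iterz f (k - n%:Z) y.
  elim: n k => [|n IH] k; first by rewrite subr0.
  by rewrite iterS iterz_homeo_inv IH -addrA -opprD -intS.
by case: j => n; [exact: pos|rewrite NegzE; exact: neg].
Qed.

Lemma continuous_iterz (i : int) : continuous (iterz f i).
Proof.
have it (g : X -> X) n : continuous g -> continuous (iter n g).
  move=> cg; elim: n => [|n IH] x; first exact: cvg_id.
  by apply: (@continuous_comp _ _ _ (iter n g) g); [exact: IH|exact: cg].
case: i => n; [exact/it/homeo_fun_continuous|exact/it/homeo_inv_continuous].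
Qed.

End iterz_theory.

Section dynamical_ball_theory.
Context {R : realType} {X : pmetricType R} (f : homeomorphism X).

(** The condition defining a ball runs over all of Z, so a shift of time by [i] only reindexes
    it. *)
Lemma preimage_iterz_dynamical_ball (delta : R) (i : int) (x : X) :
  iterz f i @^-1` dynamical_ball f delta x =
  dynamical_ball f delta (iterz f (- i) x).
Proof.
apply/seteqP; split => y xy j.
  by move: (xy (j - i)); rewrite iterzD subrK iterzD.
by move: (xy (j + i)); rewrite !iterzD addrK.
Qed.

End dynamical_ball_theory.

(** * Borel measurability and integrability of continuous maps *)

Lemma continuous_measurable_borel (X Y : ptopologicalType) (g : X -> Y) :
  continuous g -> measurable_fun [set: borel X] (g : borel X -> borel Y).
Proof.
move=> /continuousP cg.
apply: (@measurability _ _ (borel X) (borel Y) setT g (@open Y)) => //.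
move=> _ [A oA <-]; rewrite setTI; apply: sub_sigma_algebra.
exact: cg.
Qed.

Lemma continuous_measurable_borel_real (R : realType) (X : ptopologicalType)
    (phi : X -> R) :
  continuous phi -> measurable_fun [set: borel X] (phi : borel X -> R).
Proof.
move=> /continuousP cphi; apply: (measurability _ (RGenOpens.measurableE R)).
move=> _ [_ [a [b ->] <-]]; rewrite setTI; apply: sub_sigma_algebra.
exact/cphi/interval_open.
Qed.

(** Compactness makes [phi] bounded, and a bounded measurable function is integrable for a finite
    measure. *)
Lemma continuous_integrable_borel (R : realType) (X : ptopologicalType)
    (P : probability (borel X) R) (phi : X -> R) :
  compact [set: X] -> continuous phi ->
  P.-integrable [set: borel X] (EFin \o (phi : borel X -> R)).
Proof.
move=> cptX cphi; apply: measurable_bounded_integrable => //.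
- apply: (le_lt_trans (probability_le1 P measurableT)); exact: ltry.
- exact: continuous_measurable_borel_real.
have /compact_bounded[M [_ Mphi]] :=
  continuous_compact (continuous_subspaceT cphi) cptX.
by exists M; split; rewrite ?num_real // => r Mr y _; apply: Mphi => //; exists y.
Qed.

(** * Finite and countable mixtures of probability measures *)

Section probability_mixtures.
Context d (T : measurableType d) (R : realType).
Local Open Scope ereal_scope.

Lemma integral_mscale (m : {measure set T -> \bar R}) (D : set T)
    (k : {nonneg R}) (g : T -> \bar R) : measurable D -> m.-integrable D g ->
  \int[mscale k m]_(x in D) g x = k%:num%:E * \int[m]_(x in D) g x.
Proof.
move=> mD ig; have mg := measurable_int _ ig.
rewrite (integralE (mscale k m) D g) (integralE m D g).
rewrite !ge0_integral_mscale//; do ?[exact: measurable_funepos|exact: measurable_funeneg].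
(* Distributing [k] over the difference must avoid an indeterminate form; integrability makes the
   integral of the negative part finite. *)
by rewrite [RHS]muleBr// fin_num_adde_defl// fin_numN integrable_neg_fin_num.
Qed.

Lemma integrable_mscale (m : {measure set T -> \bar R}) (D : set T)
    (k : {nonneg R}) (g : T -> \bar R) : measurable D -> m.-integrable D g ->
  (mscale k m).-integrable D g.
Proof.
move=> mD ig; have mg := measurable_int _ ig.
move/integrableP: (ig) => [_ fing]; apply/integrableP; split => //.
rewrite ge0_integral_mscale//; last exact: measurableT_comp.
by rewrite lte_mul_pinfty// ge0_fin_numE// integral_ge0.
Qed.

Section convex_combination.
Variables (P Q : probability T R) (t : R) (t01 : (0 <= t <= 1)%R).

Let t_ge0 : (0 <= t)%R. Proof. by case/andP: t01. Qed.

Let onemt_ge0 : (0 <= 1 - t)%R. Proof. by rewrite subr_ge0; case/andP: t01. Qed.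

Definition mixture : set T -> \bar R :=
  measure_add
    (mscale (NngNum onemt_ge0) P) (mscale (NngNum t_ge0) Q).

HB.instance Definition _ := Measure.on mixture.

Lemma mixtureE A : mixture A = (1 - t)%:E * P A + t%:E * Q A.
Proof. by rewrite /mixture measure_addE. Qed.

Let mixture_setT : mixture setT = 1.
Proof. by rewrite mixtureE !probability_setT !mule1 -EFinD subrK. Qed.

HB.instance Definition _ := Measure_isProbability.Build _ _ _ mixture mixture_setT.

(** A sum of two nonnegative terms vanishes only if both do, and [Q] has positive weight. *)
Lemma mixture_eq0 A : (0 < t)%R -> (Q A = 0 -> P A = 0) ->
  mixture A = 0 <-> Q A = 0.
Proof.
move=> t0 QP; rewrite mixtureE; split => [|QA]; last by rewrite QP// QA !mule0 adde0.
move=> /eqP; rewrite padde_eq0; [|by rewrite mule_ge0|].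
  by move=> /andP[_]; rewrite mule_eq0 eqe gt_eqF//= => /eqP.
by rewrite mule_ge0.
Qed.

Lemma Rintegral_mixture (g : T -> R) :
  P.-integrable setT (EFin \o g) -> Q.-integrable setT (EFin \o g) ->
  (\int[mixture]_x g x = (1 - t) * \int[P]_x g x + t * \int[Q]_x g x)%R.
Proof.
move=> iP iQ; rewrite /Rintegral integral_measure_add//.
- rewrite !integral_mscale// fineD ?fineM// ?fin_numM//; exact: integrable_fin_num.
- exact: integrable_mscale.
- exact: integrable_mscale.
Qed.

End convex_combination.

Section geometric_mixture.
Variable P : nat -> probability T R.

(** The exponent [k.+1] makes the weights sum to 1; all of them are positive, so every [P k] counts
    for null sets. *)
Definition geometric_mixture : set T -> \bar R :=
  mseries (fun k => mscale (((2 ^ k.+1)%:R^-1)%:nng : {nonneg R})%R (P k)) 0.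

HB.instance Definition _ := Measure.on geometric_mixture.

Lemma geometric_mixtureE A :
  geometric_mixture A = \sum_(k <oo) ((2 ^ k.+1)%:R^-1)%R%:E * P k A.
Proof. by []. Qed.

Let geometric_mixture_setT : geometric_mixture setT = 1.
Proof.
rewrite geometric_mixtureE; apply/cvg_lim => //.
have := @cvg_geometric_eseries_half R 1%R 0; rewrite expr0 divr1.
apply: cvg_trans; rewrite (_ : (fun _ => _) =
  eseries (fun k => (1 / (2 ^ (k + 1))%:R)%R%:E))//.
apply/funext => n; apply: eq_bigr => k _.
by rewrite probability_setT mule1 addn1 div1r.
Qed.

HB.instance Definition _ :=
  Measure_isProbability.Build _ _ _ geometric_mixture geometric_mixture_setT.

Lemma geometric_mixture_eq0 A :
  geometric_mixture A = 0 <-> forall k, P k A = 0.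
Proof.
rewrite geometric_mixtureE; split => [P0 k|P0]; last first.
  by rewrite eseries0// => k _ _; rewrite P0 mule0.
have ge0 j : 0 <= ((2 ^ j.+1)%:R^-1)%R%:E * P j A by rewrite mule_ge0.
(* A single term is at most the partial sum ending with it, hence at most the whole series, which is
   0. *)
have : ((2 ^ k.+1)%:R^-1)%R%:E * P k A <= 0.
  rewrite -P0; apply: le_trans (nneseries_lim_ge k.+1 _) => //.
  by rewrite big_nat_recr//= leeDr// sume_ge0.
move=> le0; have /eqP : ((2 ^ k.+1)%:R^-1)%R%:E * P k A = 0.
  by apply/eqP; rewrite eq_le le0 ge0.
by rewrite mule_eq0 eqe invr_eq0 pnatr_eq0 expn_eq0 /= => /eqP.
Qed.

End geometric_mixture.
End probability_mixtures.

(** * Invariance of supports and the mean over an orbit of measures *)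

Section orbit_mixture.
Context {R : realType} {X : pmetricType R} (f : homeomorphism X).

Definition iterz_mfun (i : int) : {mfun borel X >-> borel X} :=
  HB.pack (iterz f i : borel X -> borel X)
    (isMeasurableFun.Build _ _ (borel X) (borel X) (iterz f i)
      (continuous_measurable_borel (@continuous_iterz X f i))).

(** If a Borel neighborhood of [iterz f i x] were null, so would be its preimage, a Borel
    neighborhood of [x]. The exponents 1 and -1 give the two inclusions. *)
Lemma supp_invariant (nu : probability (borel X) R) :
  (forall (i : int) A, nu A = 0%E -> nu (iterz f i @^-1` A) = 0%E) ->
  f @` supp nu = supp nu.
Proof.
move=> nuf.
have suppf i x : supp nu x -> supp nu (iterz f i x).
  move=> sx U xU mU; rewrite lt0e measure_ge0 andbT; apply/eqP => /(nuf i) nuU.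
  suff : (0 < nu (iterz f i @^-1` U))%E by rewrite nuU ltxx.
  apply: sx; first exact: continuous_iterz.
  by rewrite -[X in measurable X]setTI;
    exact: (continuous_measurable_borel (@continuous_iterz X f i) measurableT mU).
apply/seteqP; split => [_ [x sx <-]|x sx]; first exact: (suppf 1).
by exists (homeo_inv f x); [exact: (suppf (Negz 0))|rewrite homeo_invK].
Qed.

(* Decoding [k : nat] by [unpickle] enumerates the integers; the codes of no
   integer contribute additional weight to [mu] itself. *)
Definition orbit_mean (mu : probability (borel X) R) : probability (borel X) R :=
  geometric_mixture (fun k => distribution mu (iterz_mfun (odflt 0 (unpickle k)))).

Lemma orbit_mean_eq0 (mu : probability (borel X) R) A :
  orbit_mean mu A = 0%E <-> forall i, mu (iterz f i @^-1` A) = 0%E.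
Proof.
rewrite geometric_mixture_eq0; split => [mu0 i|mu0 k]; last exact: mu0.
(* Every integer [i] occurs in the enumeration, at its own code. *)
by have := mu0 (pickle i); rewrite pickleK.
Qed.

End orbit_mixture.

Theorem theorem1 (R : realType) (X : pmetricType R) (f : homeomorphism X)
    (cptX : compact [set: X]) :
  expansive_measures f !=set0 <->
  exists D : set (weak_star X),
    [/\ D !=set0,
        dense_in (expansive_measures f) D &
        forall mu, D mu -> f @` supp mu = supp mu].
Proof.
split=> [[mu0 exmu0]|[D [[mu Dmu] [/(_ mu Dmu) exmu _] _]]]; last by exists mu.
pose D : set (weak_star X) :=
  [set mu | expansive_measures f mu /\ f @` supp mu = supp mu].
(* The weight of the orbit mean is [1 / (n + 1)]: positive for every [n], which fixes the null sets,
   and tending to 0, which gives convergence to [mu]. *)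
have h01 n : 0 <= (@harmonic R n) <= 1.
  by rewrite harmonic_ge0 /= invf_le1// ler1n.
pose approx (mu : weak_star X) n : weak_star X :=
  mixture mu (orbit_mean f mu) (h01 n).
have approx_eq0 mu n A :
    approx mu n A = 0%E <->
    forall i, (mu : probability (borel X) R) (iterz f i @^-1` A) = 0%E.
  rewrite -orbit_mean_eq0; apply: mixture_eq0; first exact: harmonic_gt0.
  (* The exponent 0 recovers [mu] itself, so null sets of the orbit mean are null for [mu]. *)
  by move=> /orbit_mean_eq0 /(_ 0).
have approxD mu n : expansive_measures f mu -> D (approx mu n).
  move=> [delta delta0 mud]; split.
    exists delta => // x; apply/approx_eq0 => i.
    by rewrite preimage_iterz_dynamical_ball.
  apply: supp_invariant => i A /approx_eq0 muA; apply/approx_eq0 => j.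
  (* Being null under all iterates is stable under a shift of the exponent. *)
  rewrite -comp_preimage (_ : _ \o _ = iterz f (i + j)); first exact: muA.
  by apply/funext => x /=; rewrite iterzD.
have approx_cvg mu : approx mu @ \oo --> mu.
  apply/weak_star_cvgP => phi cphi.
  have iphi P := continuous_integrable_borel P cptX cphi.
  pose a : R := \int[mu : probability (borel X) R]_x phi x.
  pose b : R := \int[orbit_mean f mu]_x phi x.
  (* The integral is affine in the weight, so weak* convergence reduces to that of [harmonic] to
     0. *)
  have int_approx : (fun n => \int[approx mu n : probability (borel X) R]_x phi x) =
      (fun n => (1 - harmonic n) * a + harmonic n * b).
    by apply/funext => n; exact: Rintegral_mixture.
  suff : (fun n => \int[approx mu n : probability (borel X) R]_x phi x) @ \oo
    --> a by [].
  rewrite int_approx.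
  rewrite [a in X in _ --> X](_ : a = (1 - 0) * a + 0 * b); last first.
    by rewrite subr0 mul1r mul0r addr0.
  apply: cvgD; apply: cvgM; [apply: cvgB| | |]; by [exact: cvg_cst|exact: cvg_harmonic].
exists D; split; [by exists (approx mu0 0); exact: approxD| |by move=> mu []].
(* The open set [O] of the subspace is the trace of a weak* open set [B], which contains [approx] of
   [nu] from some index [n] on. *)
split=> [mu []//|O [nu Onu] [B oB BO]].
have exnu : expansive_measures f (set_val nu) by exact: set_valP.
have Bnu : B (set_val nu) by move: Onu; rewrite -BO.
have [n _ /(_ n (leqnn n)) Bn] := approx_cvg _ B (open_nbhs_nbhs (conj oB Bnu)).
have Dn := approxD _ n exnu.
exists (SigSub (mem_set Dn.1)); split; last by [].
by rewrite -BO.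
Qed.
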